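(* Let $F$ be a topological linear cone over a totally ordered field $\mathbb{K}$. There exists a topology on $\mathrm{span}(F)$ such that (i) $\mathrm{span}(F)$ is a topological vector space over $\mathbb{K}$; (ii) $\iota:F\to\mathrm{span}(F)$ is continuous; (iii) for any topological vector space $W$ over $\mathbb{K}$ and any continuous $\mathbb{K}_+$-linear map $f:F\to W$, the unique $\mathbb{K}$-linear map $\tilde f:\mathrm{span}(F)\to W$ such that $f=\tilde f\circ\iota$ is continuous.
   Context: A totally ordered field $\mathbb{K}$ (a field with a total order compatible with addition and with multiplication of nonnegative elements) carries its order topology, with which it is a topological field; $\mathbb{K}_+=\{\lambda\ge 0\}$. A linear cone over $\mathbb{K}$ is a commutative, cancellative monoid $(F,+)$ with a scalar multiplication $\mathbb{K}_+\times F\to F$ such that $\lambda(v+w)=\lambda v+\lambda w$, $(\lambda+\mu)v=\lambda v+\mu v$, $\lambda(\mu v)=(\lambda\mu)v$, $1v=v$. A topological linear cone (topological cone) is a linear cone with a topology such that addition $F\times F\to F$ and scalar multiplication $\mathbb{K}_+\times F\to F$ are continuous. A map $f$ from $F$ to a linear cone or vector space over $\mathbb{K}$ is $\mathbb{K}_+$-linear if $f(\lambda v+\mu w)=\lambda f(v)+\mu f(w)$ for $\lambda,\mu\in\mathbb{K}_+$. $(\mathrm{span}(F),\iota)$ is the $\mathbb{K}$-vector space with $\mathbb{K}_+$-linear map $\iota:F\to\mathrm{span}(F)$, unique up to unique isomorphism, such that every $\mathbb{K}_+$-linear map $f$ from $F$ to a $\mathbb{K}$-vector space $W$ factors as $f=\tilde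 f\circ\iota$ for a unique $\mathbb{K}$-linear $\tilde f:\mathrm{span}(F)\to W$. Concretely, $\mathrm{span}(F)=(F\times F)/\sim$ with $(v_1,w_1)\sim(v_2,w_2)$ iff $v_1+w_2=v_2+w_1$, and $\iota(v)=[(v,0)]$. A topological vector space over $\mathbb{K}$ is a $\mathbb{K}$-vector space with a topology for which addition and scalar multiplication $\mathbb{K}\times W\to W$ are continuous; no separation axiom is assumed. *)

(* Defs.v *)
From HB Require Import structures.
From mathcomp Require Import all_boot all_order all_algebra generic_quotient.
From mathcomp Require Import interval_inference.
From mathcomp Require Import all_classical topology normedtype.
Set Implicit Arguments.
Unset Strict Implicit.
Unset Printing Implicit Defensive.
Import Order.TTheory GRing.Theory Num.Theory.
Import numFieldTopology.Exports.
Local Open Scope classical_set_scope.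
Local Open Scope ring_scope.
Local Open Scope quotient_scope.

(* A totally ordered field is a [realFieldType]: its norm is the absolute value
   determined by the order, and the topology that [numFieldTopology.Exports]
   gives it is the order topology ([real_order_nbhsE]).  K_+ is [{nonneg K}]
   with the subspace topology. *)
HB.instance Definition _ (K : realFieldType) := Choice.on {nonneg K}.
HB.instance Definition _ (K : realFieldType) := Topological.copy {nonneg K}
  (initial_topology (fun a : {nonneg K} => a%:num : K)).

Definition nonneg0 (K : realFieldType) : {nonneg K} := 0%:nng.
Definition nonneg1 (K : realFieldType) : {nonneg K} := 1%:nng.
Definition nonneg_add (K : realFieldType) (a b : {nonneg K}) : {nonneg K} :=
  (a%:num + b%:num)%:nng.
Definition nonneg_mul (K : realFieldType) (a b : {nonneg K}) : {nonneg K} :=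
  (a%:num * b%:num)%:nng.

HB.mixin Record Nmodule_isLinearCone (K : realFieldType) F
    & GRing.Nmodule F := {
  cone_scale : {nonneg K} -> F -> F;
  cone_addI : forall v : F, injective (+%R v);
  cone_scaleDr : forall a v w,
    cone_scale a (v + w) = cone_scale a v + cone_scale a w;
  cone_scaleDl : forall a b v,
    cone_scale (nonneg_add a b) v = cone_scale a v + cone_scale b v;
  cone_scaleA : forall a b v,
    cone_scale a (cone_scale b v) = cone_scale (nonneg_mul a b) v;
  cone_scale1 : forall v, cone_scale (nonneg1 K) v = v
}.

#[short(type="linearConeType")]
HB.structure Definition LinearCone (K : realFieldType) :=
  { F of GRing.Nmodule F & Nmodule_isLinearCone K F }.

Notation "a *c: v" := (cone_scale a v) (at level 40) : ring_scope.

HB.mixin Record isTopologicalCone (K : realFieldType) F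
    & Topological F & LinearCone K F := {
  cone_scale_continuous : continuous (fun z : {nonneg K} * F => z.1 *c: z.2)
}.

(* Continuity of the addition is part of [TopologicalNmodule]. *)
#[short(type="topologicalConeType")]
HB.structure Definition TopologicalCone (K : realFieldType) :=
  { F of TopologicalNmodule F & LinearCone K F & isTopologicalCone K F }.

Definition nonneg_linear (K : realFieldType) (F : linearConeType K)
    (W : lmodType K) (f : F -> W) : Prop :=
  forall (a b : {nonneg K}) (v w : F),
    f (a *c: v + b *c: w) = a%:num *: f v + b%:num *: f w.

Section Span.
Variables (K : realFieldType) (F : linearConeType K).
Implicit Types (x y z : F * F) (a b : K) (p q : {nonneg K}) (u v w : F).

Definition span_rel x y : bool := x.1 + y.2 == y.1 + x.2 :> F.

Fact cone_addIr w : injective (fun v : F => v + w).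
Proof. by move=> u v; rewrite ![_ + w]addrC => /cone_addI. Qed.

Fact span_rel_equiv : equiv_class_of span_rel.
Proof.
split=> [x|x y|y x z]; rewrite /span_rel; [exact: eqxx|exact: eq_sym|].
move=> /eqP xy /eqP yz; apply/eqP/(@cone_addIr (y.2 + y.1)).
rewrite addrACA xy [z.2 + _]addrC yz.
by rewrite addrC [y.1 + _]addrC addrACA.
Qed.

Canonical span_equiv := EquivRelPack span_rel_equiv.

Definition cone_span := {eq_quot span_equiv}.
HB.instance Definition _ := Choice.on cone_span.
HB.instance Definition _ := EqQuotient.on cone_span.

Lemma pi_spanP x y :
  (\pi_cone_span x = \pi_cone_span y) <-> (x.1 + y.2 = y.1 + x.2).
Proof. by split=> [/eqquotP/eqP|?]; last exact/eqquotP/eqP. Qed.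

Definition span_add (s t : cone_span) : cone_span :=
  \pi_cone_span ((repr s).1 + (repr t).1, (repr s).2 + (repr t).2).
Definition span_opp (s : cone_span) : cone_span :=
  \pi_cone_span ((repr s).2, (repr s).1).

Fact pos_part_ge0 a : 0 <= Num.max a 0.
Proof. by rewrite le_max lexx orbT. Qed.
Definition pos_part a : {nonneg K} := NngNum (pos_part_ge0 a).
(* a(v, w) = (a^+ v + a^- w, a^+ w + a^- v), where a = a^+ - a^-. *)
Definition span_scale a (s : cone_span) : cone_span :=
  let p := pos_part a in let n := pos_part (- a) in
  \pi_cone_span (p *c: (repr s).1 + n *c: (repr s).2,
            p *c: (repr s).2 + n *c: (repr s).1).

Lemma reprP x :
  (repr (\pi_cone_span x)).1 + x.2 = x.1 + (repr (\pi_cone_span x)).2.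
Proof. by apply/pi_spanP; rewrite reprK. Qed.

Lemma span_addE x y :
  span_add (\pi_cone_span x) (\pi_cone_span y) = \pi_cone_span (x.1 + y.1, x.2 + y.2).
Proof. by apply/pi_spanP => /=; rewrite addrACA !reprP addrACA. Qed.

Lemma span_oppE x : span_opp (\pi_cone_span x) = \pi_cone_span (x.2, x.1).
Proof. by apply/pi_spanP => /=; rewrite addrC -reprP addrC. Qed.

Lemma span_scaleE a x p q : a = p%:num - q%:num ->
  span_scale a (\pi_cone_span x) =
  \pi_cone_span (p *c: x.1 + q *c: x.2, p *c: x.2 + q *c: x.1).
Proof.
move=> apq; rewrite /span_scale.
set y := repr _; set p' := pos_part a; set q' := pos_part (- a).
have xy : y.1 + x.2 = x.1 + y.2 by exact: reprP.
have pq : nonneg_add p' q = nonneg_add p q'.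
  apply: val_inj => /=; have -> : p%:num = a + q%:num by rewrite apq subrK.
  rewrite addrAC; congr (_ + _); have [a0|a0] := lerP 0 a.
    by rewrite max_r ?oppr_le0// addr0.
  by rewrite max_l ?subrr// oppr_ge0 ltW.
transitivity (\pi_cone_span (p' *c: x.1 + q' *c: x.2, p' *c: x.2 + q' *c: x.1)).
  apply/pi_spanP => /=; rewrite addrACA [RHS]addrACA -!cone_scaleDr.
  by rewrite xy [y.2 + _]addrC -xy [y.1 + _]addrC.
apply/pi_spanP => /=.
have pqE v : p' *c: v + q *c: v = p *c: v + q' *c: v.
  by rewrite -!cone_scaleDl pq.
rewrite [p *c: x.2 + _]addrC addrACA pqE [q' *c: x.2 + _]addrC -(pqE x.2).
by rewrite [p' *c: x.2 + q *c: x.2]addrC addrACA [q' *c: x.1 + _]addrC.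
Qed.

Fact span_addA : associative span_add.
Proof.
elim/quotW => x; elim/quotW => y; elim/quotW => z.
by rewrite (span_addE y z) (span_addE x y) !span_addE /= !addrA.
Qed.
Fact span_addC : commutative span_add.
Proof.
elim/quotW => x; elim/quotW => y.
by rewrite !span_addE [x.1 + _]addrC [x.2 + _]addrC.
Qed.
Fact span_add0 : left_id (\pi_cone_span (0, 0)) span_add.
Proof. by elim/quotW => -[v w]; rewrite span_addE /= !add0r. Qed.
Fact span_addN : left_inverse (\pi_cone_span (0, 0)) span_opp span_add.
Proof.
elim/quotW => x; rewrite span_oppE span_addE.
by apply/pi_spanP; rewrite /= addr0 add0r addrC.
Qed.
HB.instance Definition _ :=
  GRing.isZmodule.Build cone_span span_addA span_addC span_add0 span_addN.

Fact pos_partB a : a = (pos_part a)%:num - (pos_part (- a))%:num.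
Proof.
rewrite /=; have [a0|a0] := lerP 0 a.
  by rewrite max_r ?oppr_le0// subr0.
by rewrite max_l ?sub0r ?opprK// oppr_ge0 ltW.
Qed.

Fact cone_scale0 v : (nonneg0 K) *c: v = 0.
Proof.
apply: (@cone_addI _ _ ((nonneg0 K) *c: v)); rewrite -cone_scaleDl [RHS]addr0.
by congr cone_scale; apply: val_inj; rewrite /= addr0.
Qed.

Fact cone_scale0r p : p *c: (0 : F) = 0.
Proof.
by apply: (@cone_addI _ _ (p *c: (0 : F))); rewrite -cone_scaleDr !addr0.
Qed.

Fact span_scaleA a b s : span_scale a (span_scale b s) = span_scale (a * b) s.
Proof.
elim/quotW: s => x.
set p := pos_part a; set q := pos_part (- a).
set r := pos_part b; set t := pos_part (- b).
pose pr : {nonneg K} := nonneg_mul p r.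
pose qt : {nonneg K} := nonneg_mul q t.
pose pt : {nonneg K} := nonneg_mul p t.
pose qr : {nonneg K} := nonneg_mul q r.
rewrite (span_scaleE _ (pos_partB b)) (span_scaleE _ (pos_partB a)) /=.
rewrite (@span_scaleE _ _ (nonneg_add pr qt) (nonneg_add pt qr)).
  rewrite -/p -/q -/r -/t !cone_scaleDr !cone_scaleDl !cone_scaleA.
  by congr (\pi_cone_span (_, _)); rewrite [qr *c: _ + _]addrC addrACA.
rewrite {1}(pos_partB a) {1}(pos_partB b) -/p -/q -/r -/t /=.
by rewrite mulrBl !mulrBr opprB opprD addrACA [- _ - _]addrC.
Qed.
Fact span_scale1 : left_id 1 span_scale.
Proof.
elim/quotW=> -[v w].
rewrite (@span_scaleE _ _ (nonneg1 K) (nonneg0 K)) /= ?subr0//.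
by rewrite !cone_scale1 !cone_scale0 !addr0.
Qed.
Fact span_scaleDr : right_distributive span_scale +%R.
Proof.
move=> a; elim/quotW => x; elim/quotW => y.
rewrite [_ + _]span_addE !(span_scaleE _ (pos_partB a)) [RHS]span_addE /=.
by rewrite !cone_scaleDr; congr (\pi_cone_span (_, _)); rewrite addrACA.
Qed.
Fact span_scaleDl s : {morph span_scale^~ s : a b / a + b}.
Proof.
move=> a b; elim/quotW: s => x; set p := pos_part a; set q := pos_part (- a).
set r := pos_part b; set t := pos_part (- b).
rewrite (@span_scaleE _ _ (nonneg_add p r) (nonneg_add q t)).
  rewrite (span_scaleE _ (pos_partB b)) (span_scaleE _ (pos_partB a)).
  rewrite [RHS]span_addE /= -/p -/q -/r -/t !cone_scaleDl.
  by congr (\pi_cone_span (_, _)); rewrite addrACA.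
by rewrite {1}(pos_partB a) {1}(pos_partB b) /= opprD addrACA.
Qed.
HB.instance Definition _ := GRing.Zmodule_isLmodule.Build K cone_span
  span_scaleA span_scale1 span_scaleDr span_scaleDl.

Definition span_iota v : cone_span := \pi_cone_span (v, 0).

Lemma span_iotaB v w : span_iota v - span_iota w = \pi_cone_span (v, w).
Proof. by rewrite [- _]span_oppE [LHS]span_addE /= addr0 add0r. Qed.

Lemma span_iota_linear : nonneg_linear span_iota.
Proof.
move=> p q v w.
have iZ (r : {nonneg K}) u : r%:num *: span_iota u = span_iota (r *c: u).
  have rE : r%:num = r%:num - (nonneg0 K)%:num by rewrite subr0.
  by rewrite [LHS](span_scaleE _ rE) /= !cone_scale0 cone_scale0r !addr0.
by rewrite !iZ [RHS]span_addE /= addr0.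
Qed.
End Span.

Section NonnegLinear.
Variables (K : realFieldType) (F : linearConeType K) (W : lmodType K).
Variable f : F -> W.
Hypothesis fL : nonneg_linear f.

Lemma nonneg_linearD : {morph f : v w / v + w}.
Proof.
move=> v w; have := fL (nonneg1 K) (nonneg1 K) v w.
by rewrite !cone_scale1 !scale1r.
Qed.

Lemma nonneg_linearZ (p : {nonneg K}) (v : F) : f (p *c: v) = p%:num *: f v.
Proof.
have := fL p (nonneg0 K) v v.
by rewrite cone_scale0 addr0 scale0r addr0.
Qed.
End NonnegLinear.

Section SpanUniversal.
Variables (K : realFieldType) (F : linearConeType K) (W : lmodType K).

Lemma span_universal (f : F -> W) : nonneg_linear f ->
  exists! g : cone_span F -> W, linear g /\ f = g \o @span_iota K F.
Proof.
move=> fL; have fD := nonneg_linearD fL; have fZ := nonneg_linearZ fL.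
pose iota := @span_iota K F; have iL : nonneg_linear iota.
  exact: span_iota_linear.
have iD := nonneg_linearD iL; have iZ := nonneg_linearZ iL.
have repr2 (s : cone_span F) : s = iota (repr s).1 - iota (repr s).2.
  by rewrite span_iotaB -surjective_pairing reprK.
pose g (s : cone_span F) := f (repr s).1 - f (repr s).2.
have gE v w : g (iota v - iota w) = f v - f w.
  rewrite /g span_iotaB; apply/eqP; rewrite subr_eq addrAC eq_sym subr_eq.
  by rewrite -!fD reprP.
have f0 : f 0 = 0 by rewrite -(cone_scale0 0) fZ scale0r.
have i0 : iota 0 = 0 by rewrite -(cone_scale0 0) iZ scale0r.
exists g; split; first split.
- move=> a s t; rewrite (repr2 s) (repr2 t).
  move: (repr s) (repr t) => [v w] [v' w'] /=; rewrite !gE (pos_partB a).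
  set p := pos_part a; set q := pos_part (- a).
  rewrite [X in g X](_ : _ = iota (p *c: v + q *c: w + v')
    - iota (p *c: w + q *c: v + w')).
    rewrite gE !fD !fZ scalerBl !scalerBr.
    by rewrite opprB opprD addrACA opprD [X in X + _ = _]addrACA.
  rewrite !iD !iZ scalerBl !scalerBr.
  by rewrite opprB [in RHS]opprD [RHS]addrACA opprD [X in _ = X + _]addrACA.
- by apply/funext => v /=; rewrite -[span_iota v]subr0 -i0 gE f0 subr0.
- move=> h [hL fh]; apply/funext => s.
  rewrite /g fh /= -/iota [in RHS](repr2 s).
  by rewrite [in RHS]addrC -(scaleN1r (iota _)) hL scaleN1r addrC.
Qed.
End SpanUniversal.

Record topology_on (T : Type) := TopologyOn {
  is_open : set_system T;
  is_openT : is_open setT;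
  is_openI : setI_closed is_open;
  is_open_bigU : forall (I : Type) (f : I -> set T),
    (forall i, is_open (f i)) -> is_open (\bigcup_i f i)
}.

Definition topologized (T : Type) (tau : topology_on T) : Type := T.

Section Topologized.
Variables (K : realFieldType) (V : lmodType K) (tau : topology_on V).
HB.instance Definition _ := GRing.Lmodule.copy (topologized tau) V.
HB.instance Definition _ := isOpenTopological.Build (topologized tau)
  (is_openT tau) (@is_openI _ tau) (@is_open_bigU _ tau).
End Topologized.

Definition is_topological_vector_space (K : realFieldType)
    (V : preTopologicalLmodType K) : Prop :=
  continuous (fun z : V * V => z.1 + z.2) /\
  continuous (fun z : K * V => z.1 *: z.2).

Lemma topological_lmod_is_tvs (K : realFieldType) (W : topologicalLmodType K) :
  is_topological_vector_space W.
Proof. by split; [exact: add_continuous|exact: scale_continuous]. Qed.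

(* Main.v *)
Require Import Defs.
From HB Require Import structures.
From mathcomp Require Import all_boot all_order all_algebra.
From mathcomp Require Import all_classical topology normedtype.
Set Implicit Arguments.
Unset Strict Implicit.
Unset Printing Implicit Defensive.
Import Order.TTheory GRing.Theory Num.Theory.
Import numFieldTopology.Exports.
Local Open Scope classical_set_scope.
Local Open Scope ring_scope.

(** The topology on the span is the finest one available: the supremum of all
    the vector space topologies on [cone_span F] for which [span_iota] is
    continuous.

    A map into a supremum of topologies is continuous as soon as it is
    continuous into each of them ([continuous_to_sup]).  Hence [span_iota]
    stays continuous, and so do the addition and the scalar multiplication:
    into each member [sigma] of the family they are continuous from [sigma],
    hence from the finer supremum ([sup_is_tvs]).

    For the universal property, let [g] be the linear extension of a
    continuous cone map [f] into a topological vector space [W].  The initial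
    topology of [g] is a vector space topology because [g] is linear
    ([initial_is_tvs]), and it makes [span_iota] continuous because
    [g \o span_iota = f].  It is thus a member of the family, so [g], which
    is continuous for it, is continuous for the supremum.  Only topologies on
    the one space [cone_span F] are compared, so the spaces [W], which do not
    form a set, never have to index the supremum. *)

Section Supremum.
Variable T : Type.
Implicit Types (P : set (topology_on T)) (A B : set T).

Definition finer_than_all P (rho : topology_on T) :=
  forall sigma, P sigma -> is_open sigma `<=` is_open rho.

(** The supremum is the intersection of all the topologies finer than the
    family, which avoids any description by finite intersections of open
    sets. *)
Definition sup_open P : set_system T :=
  [set A | forall rho, finer_than_all P rho -> is_open rho A].

Fact sup_openT P : sup_open P setT.
Proof. by move=> rho _; exact: is_openT. Qed.

Fact sup_openI P : setI_closed (sup_open P).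
Proof.
move=> A B oA oB rho Prho.
by apply: is_openI; [exact: oA|exact: oB].
Qed.

Fact sup_open_bigU P (I : Type) (f : I -> set T) :
  (forall i, sup_open P (f i)) -> sup_open P (\bigcup_i f i).
Proof. by move=> of_ rho Prho; apply: is_open_bigU => i; exact: of_. Qed.

Definition sup_topology_on P : topology_on T :=
  TopologyOn (@sup_openT P) (@sup_openI P) (@sup_open_bigU P).

Lemma sup_topology_on_finer P sigma :
  P sigma -> is_open sigma `<=` is_open (sup_topology_on P).
Proof. by move=> Psigma A oA rho Prho; exact: Prho oA. Qed.

(** The final topology of a map is the finest one that makes it continuous; it
    serves as the competitor in the intersection that defines the supremum. *)
Section Final.
Variables (X : topologicalType) (h : X -> T).

Let final_open : set_system T := [set A | open (h @^-1` A)].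

Fact final_openT : final_open setT.
Proof. by rewrite /final_open /= preimage_setT; exact: openT. Qed.

Fact final_openI : setI_closed final_open.
Proof.
by move=> A B oA oB; rewrite /final_open /= preimage_setI; exact: openI.
Qed.

Fact final_open_bigU (I : Type) (f : I -> set T) :
  (forall i, final_open (f i)) -> final_open (\bigcup_i f i).
Proof.
move=> of_; rewrite /final_open /= preimage_bigcup.
by apply: bigcup_open => i _; exact: of_.
Qed.

Definition final_topology_on : topology_on T :=
  TopologyOn final_openT final_openI final_open_bigU.
End Final.
End Supremum.

Definition initial_topology_on (T : choiceType) (X : topologicalType)
    (g : T -> X) : topology_on T :=
  let T' : topologicalType := initial_topology g in
  TopologyOn (@openT T') (@openI T') (fun I f fop =>
    @bigcup_open T' I setT f (fun i _ => fop i)).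

Section VectorTopologies.
Variables (K : realFieldType) (V : lmodType K).

(** Continuity of [h] into each [sigma] says that the final topology of [h] is
    finer than each [sigma]; it is then finer than the supremum. *)
Lemma continuous_to_sup (P : set (topology_on V)) (X : topologicalType)
    (h : X -> V) :
  (forall sigma, P sigma -> continuous (h : X -> topologized sigma)) ->
  continuous (h : X -> topologized (sup_topology_on P)).
Proof.
move=> hc; apply/continuousP => A /(_ (final_topology_on h)); apply.
by move=> sigma /hc /continuousP.
Qed.

Lemma continuous_sup_id (P : set (topology_on V)) (sigma : topology_on V) :
  P sigma ->
  continuous (id : topologized (sup_topology_on P) -> topologized sigma).
Proof. by move=> Psigma; apply/continuousP; exact: sup_topology_on_finer. Qed.

Lemma continuous_comp_pair (X X' Y Y' Z : topologicalType)
    (m : Y * Y' -> Z) (f : X -> Y) (g : X' -> Y') :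
  continuous m -> continuous f -> continuous g ->
  continuous (fun z : X * X' => m (f z.1, g z.2)).
Proof.
move=> mc fc gc z; apply: (@cvg_comp _ _ _ _ m); last exact: mc.
by apply: cvg_pair; apply: cvg_comp; [exact: cvg_fst|exact: fc|
                                      exact: cvg_snd|exact: gc].
Qed.

(** Each operation is checked into one member [sigma] of the family at a time;
    there it factors through the identity from the supremum to [sigma],
    followed by the operation of [sigma]. *)
Lemma sup_is_tvs (P : set (topology_on V)) :
  (forall sigma, P sigma -> is_topological_vector_space (topologized sigma)) ->
  is_topological_vector_space (topologized (sup_topology_on P)).
Proof.
move=> Ptvs; split; apply: continuous_to_sup => sigma Psigma;
  have [addc scalec] := Ptvs _ Psigma; have idc := continuous_sup_id Psigma.
- exact: (continuous_comp_pair addc idc idc).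
- exact: (continuous_comp_pair scalec (fun a => cvg_id) idc).
Qed.

Section Initial.
Variables (W : topologicalLmodType K) (g : V -> W).
Local Notation S := (topologized (initial_topology_on g)).

Lemma continuous_to_initial (X : topologicalType) (h : X -> V) :
  continuous (g \o h) -> continuous (h : X -> S).
Proof.
move=> /continuousP ghc; apply/continuousP => _ [B oB <-].
exact: ghc.
Qed.

Lemma continuous_from_initial : continuous (g : S -> W).
Proof. by apply/continuousP => B oB; exists B. Qed.

(** By linearity, following an operation of [V] by [g] amounts to following [g]
    by the operation of [W], and the latter composite is continuous. *)
Lemma initial_is_tvs : linear g -> is_topological_vector_space S.
Proof.
move=> gL; have gc := continuous_from_initial.
pose gl : {linear V -> W} := HB.pack g (GRing.isLinear.Build _ _ _ _ g gL).
split; apply: continuous_to_initial.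
- rewrite (_ : _ \o _ = fun z => g z.1 + g z.2).
    exact: (continuous_comp_pair (@add_continuous W) gc gc).
  by apply/funext => z; exact: (linearD gl).
- rewrite (_ : _ \o _ = fun z => z.1 *: g z.2).
    exact: (continuous_comp_pair (@scale_continuous _ W) (fun a => cvg_id) gc).
  by apply/funext => z; exact: (linearZ_LR gl).
Qed.
End Initial.
End VectorTopologies.

Theorem theorem2p11 (K : realFieldType) (F : topologicalConeType K) :
  exists tau : topology_on (cone_span F),
    let S := topologized tau in
    let iota : F -> S := @span_iota K F in
    [/\ is_topological_vector_space S,
        continuous iota
      & forall (W : topologicalLmodType K) (f : F -> W),
          nonneg_linear f -> continuous f ->
          exists g : S -> W,
            unique (fun h : S -> W => linear h /\ f = h \o iota) g /\
            continuous g].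
Proof.
pose P : set (topology_on (cone_span F)) := [set sigma |
  is_topological_vector_space (topologized sigma) /\
  continuous (@span_iota K F : F -> topologized sigma)].
exists (sup_topology_on P) => S iota; split.
- by apply: sup_is_tvs => sigma [].
- by apply: continuous_to_sup => sigma [].
move=> W f fL fc; have [g [[gL fE] gU]] := span_universal fL.
exists g; split=> //.
have Pg : P (initial_topology_on g).
  by split; [exact: initial_is_tvs|apply: continuous_to_initial; rewrite -fE].
move=> s; apply: cvg_comp; first exact: (continuous_sup_id Pg).
exact: continuous_from_initial.
Qed.
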